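(* Let $Q_0\neq0$ be a constant, let $H_0$ be a prescribed boundary value for $H$, and let $f=f(x)$ be a given (sufficiently smooth) function, the desired vertical velocity, i.e. $\overline{w}=f$. Let the functions $\overline{p}_{nh},H,z_b,\overline{u}$ of $x$, with $H>0$ satisfying the boundary condition given by $H_0$, be defined by $$\overline{p}_{nh}=\frac{Q_0}{2}\frac{\partial f}{\partial x},$$ $$\left(\frac g2H-\frac{Q_0^2}{H^2}\right)\frac{\partial H}{\partial x}=-\frac{H}{Q_0}\left(gH+Q_0\frac{\partial f}{\partial x}\right)f-\frac{Q_0}{2}H\frac{\partial^2f}{\partial x^2},$$ $$\frac{\partial z_b}{\partial x}=-\frac12\frac{\partial H}{\partial x}+\frac{Hf}{Q_0},$$ $$\overline{u}=\frac{Q_0}{H}.$$ Then $(H,\overline{u},\overline{w}=f,\overline{p}_{nh})$, with bottom $z_b$, is a stationary (time-independent) solution of the system $$\frac{\partial H}{\partial t}+\frac{\partial}{\partial x}(H\overline{u})=0,$$ $$\frac{\partial}{\partial t}(H\overline{u})+\frac{\partial}{\partial x}\left(H\overline{u}^2+\frac g2H^2+H\overline{p}_{nh}\right)=-(gH+2\overline{p}_{nh})\frac{\partial z_b}{\partial x},$$ $$\frac{\partial}{\partial t}(H\overline{w})+\frac{\partial}{\partial x}(H\overline{w}\,\overline{u})=2\overline{p}_{nh},$$ $$\frac{\partial}{\partial t}\left(\frac{\eta^2-z_b^2}{2}\right)+\frac{\partial}{\partial x}\left(\frac{\eta^2-z_b^2}{2}\,\overline{u}\right)=H\overline{w},\qquad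 \eta=H+z_b.$$
   Context: $x$ is the horizontal coordinate, $t$ time, $g$ the constant gravity acceleration, $z_b$ the bottom elevation, $H$ the water height, $\eta=H+z_b$ the free surface, $\overline{u},\overline{w}$ the depth-averaged horizontal and vertical velocities, $\overline{p}_{nh}$ the depth-averaged non-hydrostatic pressure. The equations for $H$ and $z_b$ in the claim are ordinary differential equations in $x$. *)

(* Defs.v *)
From Stdlib Require Import Reals.
From Coquelicot Require Import Coquelicot.
Open Scope R_scope.

Definition Rbar_interval (a b : Rbar) (x : R) : Prop :=
  Rbar_lt a x /\ Rbar_lt x b.

(* [h0] is the value of [h] at the endpoint [e] of (a, b), taken as a trace:
   the limit of [h x] as x tends to [e] from inside (a, b). Either endpoint is
   allowed, and it may be infinite. *)
Definition boundary_value (a b e : Rbar) (h : R -> R) (h0 : R) : Prop :=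
  (e = a \/ e = b) /\
  filterlim h (within (Rbar_interval a b) (Rbar_locally e)) (locally h0).

(* Fields are functions of (t, x), time first. *)
Definition pd_t (F : R -> R -> R) (t x : R) : R := Derive (fun s => F s x) t.
Definition pd_x (F : R -> R -> R) (t x : R) : R := Derive (fun y => F t y) x.

(* [Derive] is total, so the existence of the derivatives is required apart. *)
Definition has_partials (F : R -> R -> R) (t x : R) : Prop :=
  ex_derive (fun s => F s x) t /\ ex_derive (fun y => F t y) x.

Definition mass_eq (H u : R -> R -> R) (t x : R) : Prop :=
  pd_t H t x + pd_x (fun t x => H t x * u t x) t x = 0.

Definition momentum_x_eq (g : R) (zb : R -> R) (H u p : R -> R -> R)
    (t x : R) : Prop :=
  pd_t (fun t x => H t x * u t x) t x
  + pd_x (fun t x => H t x * u t x ^ 2 + g / 2 * H t x ^ 2 + H t x * p t x) t x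
  = - (g * H t x + 2 * p t x) * Derive zb x.

Definition momentum_z_eq (H u w p : R -> R -> R) (t x : R) : Prop :=
  pd_t (fun t x => H t x * w t x) t x
  + pd_x (fun t x => H t x * w t x * u t x) t x
  = 2 * p t x.

Definition free_surface (zb : R -> R) (H : R -> R -> R) (t x : R) : R :=
  H t x + zb x.

Definition divergence_eq (zb : R -> R) (H u w : R -> R -> R)
    (t x : R) : Prop :=
  let eta := free_surface zb H in
  pd_t (fun t x => (eta t x ^ 2 - zb x ^ 2) / 2) t x
  + pd_x (fun t x => (eta t x ^ 2 - zb x ^ 2) / 2 * u t x) t x
  = H t x * w t x.

(* Classical solution at all times on the spatial domain [I]. *)
Definition solution (I : R -> Prop) (g : R) (zb : R -> R)
    (H u w p : R -> R -> R) : Prop :=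
  forall t x : R, I x ->
    (has_partials H t x /\ has_partials u t x /\ has_partials w t x /\
     has_partials p t x /\ ex_derive zb x) /\
    mass_eq H u t x /\
    momentum_x_eq g zb H u p t x /\
    momentum_z_eq H u w p t x /\
    divergence_eq zb H u w t x.

Definition time_independent (I : R -> Prop) (F : R -> R -> R) : Prop :=
  forall s t x : R, I x -> F s x = F t x.

Definition stationary_solution (I : R -> Prop) (g : R) (zb : R -> R)
    (H u w p : R -> R -> R) : Prop :=
  (time_independent I H /\ time_independent I u /\
   time_independent I w /\ time_independent I p) /\
  solution I g zb H u w p.

(* Main.v *)
Require Import Defs.
From Stdlib Require Import Reals Lra Lia.
From Coquelicot Require Import Coquelicot.
Open Scope R_scope.

(* Since H u = Q0 locally, mass conservation is immediate, the vertical momentum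
   equation reads Q0 f' = 2 p, and the divergence equation reads
   (Q0 (H + 2 zb) / 2)' = H f, which is the equation for zb.  Eliminating zb',
   u and p from the horizontal momentum equation leaves the equation for H. *)

(** Equations assumed pointwise on the interval, such as [u x = Q0 / H x], thereby hold near each of
    its points and may be differentiated there. *)
Lemma open_Rbar_interval (a b : Rbar) : open (Rbar_interval a b).
Proof.
  apply open_and; [apply open_Rbar_gt | apply open_Rbar_lt].
Qed.

(* [auto_derive] states its results with eta-expanded functions, which
   [rewrite] does not identify with the original ones. *)
Ltac eta_Derive h x :=
  change (Derive (fun y => h y) x) with (Derive h x).

(** The value of the derivative starts as an existential variable: [auto_derive] computes it and
    [reflexivity] instantiates it, while [tauto] takes differentiability from the context. *)
Ltac compute_Derive :=
  erewrite is_derive_unique by (auto_derive; [tauto | reflexivity]).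

Theorem proposition6 (g : R) (hg : 0 < g)
    (a b : Rbar) (hab : Rbar_lt a b)
    (Q0 : R) (hQ0 : Q0 <> 0) (H0 : R) (e : Rbar)
    (f : R -> R)
    (hf : forall x : R, Rbar_interval a b x ->
            forall k : nat, (k <= 2)%nat -> ex_derive_n f k x)
    (p H zb u : R -> R)
    (hp : forall x : R, Rbar_interval a b x -> p x = Q0 / 2 * Derive f x)
    (hHpos : forall x : R, Rbar_interval a b x -> 0 < H x)
    (hHdiff : forall x : R, Rbar_interval a b x -> ex_derive H x)
    (hH : forall x : R, Rbar_interval a b x ->
            (g / 2 * H x - Q0 ^ 2 / H x ^ 2) * Derive H x
            = - (H x / Q0) * (g * H x + Q0 * Derive f x) * f x
              - Q0 / 2 * H x * Derive_n f 2 x)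
    (hH0 : boundary_value a b e H H0)
    (hzbdiff : forall x : R, Rbar_interval a b x -> ex_derive zb x)
    (hzb : forall x : R, Rbar_interval a b x ->
            Derive zb x = - (1 / 2) * Derive H x + H x * f x / Q0)
    (hu : forall x : R, Rbar_interval a b x -> u x = Q0 / H x) :
  stationary_solution (Rbar_interval a b) g zb
    (fun _ x => H x) (fun _ x => u x) (fun _ x => f x) (fun _ x => p x).
Proof.
  split; [repeat split |].
  intros t x Ix.
  assert (Hpos := hHpos x Ix).
  assert (Hneq : H x <> 0) by lra.
  assert (near : locally x (Rbar_interval a b))
    by exact (open_Rbar_interval a b x Ix).
  assert (ef : ex_derive f x) by exact (hf x Ix 1%nat ltac:(lia)).
  (* [ex_derive_n f 2 x] unfolds to differentiability of [Derive_n f 1], which is convertible to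
     [Derive f]. *)
  assert (ef' : ex_derive (Derive f) x) by exact (hf x Ix 2%nat ltac:(lia)).
  assert (eH := hHdiff x Ix).
  assert (ez := hzbdiff x Ix).
  assert (du : is_derive u x (- Q0 * Derive H x / H x ^ 2)).
  { apply is_derive_ext_loc with (fun y => Q0 / H y).
    - apply filter_imp with (2 := near); intros y Iy; symmetry; exact (hu y Iy).
    - auto_derive; [tauto |].
      eta_Derive H x; field; exact Hneq. }
  assert (dp : is_derive p x (Q0 / 2 * Derive_n f 2 x)).
  { apply is_derive_ext_loc with (fun y => Q0 / 2 * Derive f y).
    - apply filter_imp with (2 := near); intros y Iy; symmetry; exact (hp y Iy).
    - apply is_derive_scal, Derive_correct, ef'. }
  assert (eu : ex_derive u x) by (eexists; exact du).
  assert (ep : ex_derive p x) by (eexists; exact dp).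
  apply is_derive_unique in du, dp.
  assert (ux := hu x Ix).
  assert (px := hp x Ix).
  assert (zx := hzb x Ix).
  assert (Hx := hH x Ix).
  assert (const_t : forall c : R, Derive (fun _ : R => c) t = 0)
    by (intro; apply Derive_const).
  split; [repeat split; first [assumption | apply ex_derive_const] |].
  unfold mass_eq, momentum_x_eq, momentum_z_eq, divergence_eq, free_surface,
    pd_t, pd_x.
  (* Every time derivative is that of a constant function of [t], so only the flux terms remain. *)
  rewrite !const_t, !Rplus_0_l.
  repeat split.
  - compute_Derive; eta_Derive H x; eta_Derive u x.
    rewrite du, ux; field; exact Hneq.
  - compute_Derive; eta_Derive H x; eta_Derive u x; eta_Derive p x.
    rewrite du, dp, ux, px, zx.
    (* With both equations in the form left minus right, the momentum residual is identically the
       residual of the equation for [H]: the terms in [Derive f x * Derive H x] cancel, and half of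
       [g * H x * Derive H x] survives. *)
    apply Rminus_diag_uniq.
    apply Rminus_diag_eq in Hx.
    rewrite <- Hx; field; auto.
  - compute_Derive; eta_Derive H x; eta_Derive u x; eta_Derive f x.
    rewrite du, ux, px; field; exact Hneq.
  - compute_Derive; eta_Derive H x; eta_Derive u x; eta_Derive zb x.
    rewrite du, ux, zx; field; auto.
Qed.
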